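(* Let $R=N\oplus Q$ be a finite-dimensional complex solvable Leibniz algebra with nilradical $N$, where $Q$ is a vector subspace complementary to $N$, such that $\dim Q=\dim(N/N^2)$. Then all derivations of $R$ are inner.
   Context: All algebras and vector spaces are finite-dimensional over $\mathbb{C}$. A (right) Leibniz algebra is a vector space $L$ with a bilinear bracket satisfying $[[x,y],z]=[[x,z],y]+[x,[y,z]]$ for all $x,y,z\in L$. Put $L^1=L$, $L^{m+1}=[L^m,L]$ and $L^{[1]}=L$, $L^{[m+1]}=[L^{[m]},L^{[m]}]$; $L$ is nilpotent (resp. solvable) if $L^m=0$ (resp. $L^{[m]}=0$) for some $m$. The nilradical is the maximal nilpotent ideal. A derivation of $L$ is a linear map $d:L\to L$ with $d([x,y])=[d(x),y]+[x,d(y)]$ for all $x,y\in L$; it is inner if it is a right multiplication operator $R_x:L\to L$, $R_x(y)=[y,x]$, for some $x\in L$. *)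

(* Defs.v *)
From HB Require Import structures.
From mathcomp Require Import all_boot all_order all_algebra.
From mathcomp Require Export sesquilinear vector reals.
From mathcomp.real_closed Require Export complex.

Set Implicit Arguments.
Unset Strict Implicit.
Unset Printing Implicit Defensive.

Import GRing.Theory.
Local Open Scope ring_scope.

Section DimensionOfQuotient.
Context {K : fieldType} {vT : vectType K}.
Implicit Types U V : {vspace vT}.

(* dim (U / V) for V <= U; subspaces in [vector] have no quotient type.  The  *)
(* lemma dim_quotE identifies it with the dimension of any concrete quotient. *)
Definition dim_quot U V : nat := (\dim U - \dim V)%N.

Lemma dim_quotE (wT : vectType K) (pi : 'Hom(vT, wT)) U V :
  (U :&: lker pi)%VS = V -> \dim (pi @: U) = dim_quot U V.
Proof.
by move=> kerE; rewrite /dim_quot -(limg_ker_dim pi U) kerE addnC addnK.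
Qed.

End DimensionOfQuotient.

Section Leibniz.
Context {K : fieldType} {L : vectType K}.
Variable br : {bilinear L -> L -> L}.
Implicit Types U V W I N : {vspace L}.

Definition right_leibniz : Prop :=
  forall x y z : L, br (br x y) z = br (br x z) y + br x (br y z).

(* [U, V], the span of all brackets; a spanning set is enough by bilinearity, *)
(* see bracketvP.                                                             *)
Definition bracketv U V : {vspace L} :=
  <<[seq br u v | u <- vbasis U, v <- vbasis V]>>%VS.

Lemma memv_bracket U V : {in U & V, forall u v, br u v \in bracketv U V}.
Proof.
move=> u v Uu Vv; rewrite (coord_vbasis Uu) (coord_vbasis Vv).
rewrite linear_sumlz; apply: memv_suml => i _.
rewrite linear_sumr; apply: memv_suml => j _.
rewrite linearZl_LR linearZr_LR !memvZ // memv_span //.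
by apply: allpairs_f; rewrite mem_nth // size_tuple.
Qed.

Lemma bracketvP {U V W} :
  reflect {in U & V, forall u v, br u v \in W} (bracketv U V <= W)%VS.
Proof.
apply: (iffP idP) => [/subvP sUVW u v Uu Vv | sUVW].
  exact/sUVW/memv_bracket.
apply/span_subvP=> _ /allpairsP[[u v] /= [Uu Vv ->]].
by rewrite sUVW ?vbasis_mem.
Qed.

(* Both series are indexed from 1, as in the usual notation: the index 0 is   *)
(* a junk value equal to U.                                                   *)
Definition lower_central U (m : nat) : {vspace L} :=
  iter m.-1 (fun V => bracketv V U) U.

Definition derived_series U (m : nat) : {vspace L} :=
  iter m.-1 (fun V => bracketv V V) U.

Definition nilpotentv U : Prop := exists m, lower_central U m = 0%VS.

Definition solvablev U : Prop := exists m, derived_series U m = 0%VS.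

Definition idealv I : Prop :=
  (bracketv I fullv <= I)%VS /\ (bracketv fullv I <= I)%VS.

Definition nilradical N : Prop :=
  [/\ idealv N, nilpotentv N
    & forall I, idealv I -> nilpotentv I -> (I <= N)%VS].

Definition derivation (d : 'End(L)) : Prop :=
  forall x y : L, d (br x y) = br (d x) y + br x (d y).

Definition inner_derivation (d : 'End(L)) : Prop :=
  exists x : L, forall y : L, d y = br y x.

End Leibniz.

(* Main.v *)
From HB Require Import structures.
Require Import Defs.
From mathcomp Require Import all_boot all_order all_algebra.

(** A generic inner derivation of R splits it into weight spaces, and every
    derivation can be corrected by inner ones until it respects this splitting
    and vanishes on generators.  Write R_x for the right multiplication
    y |-> [y, x], and N^i for the lower central series of N.

    The right multiplications act on V = N/N^2, whose dimension k is that of Q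
    (lemma [quotient_coord]; the matrices [rho x]).  Two facts are used
    throughout.  If [rho b] is nilpotent, then so is R_b on N, because N is
    generated by N modulo N^2 ([nilpotent_rmul]); hence adjoining such elements
    to N, as long as they bracket into N, gives a nilpotent subalgebra, and the
    maximality of N keeps them inside N ([nilpotent_absorb]).  And in
    characteristic 0 a commutator which commutes with one of its two entries is
    nilpotent ([commutator_nilpotent]).  Going up the derived series from its
    last term, these show that each derived algebra is contained in N
    ([derived_absorb]).  So [R, R] lies in N, without Lie's theorem.

    Therefore the matrices [rho x] commute, and no nonzero x in Q has a
    nilpotent one.  Triangularizing them simultaneously, the k diagonal entries
    are k independent linear forms on the k-dimensional space Q, so they can be
    given any values ([exists_split_element]).  Choose x0 with diagonal entries
    k+1, ..., 2k.  All eigenvalues of T = R_x0 on N^2 are sums of at least two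
    of these, so they exceed 2k: T is bijective on N, and T - c is bijective on
    N^2 for each of the k eigenvalues c ([shift_surj], [shift_inj]).  Thus
    ker T is an abelian complement of N, again of dimension k, and T has
    one-dimensional eigenspaces spanned by e_1, ..., e_k, which generate N and
    are eigenvectors of every R_q with q in ker T.

    For a derivation d, the commutator of d and T is R_{d x0}; as T is
    invertible on N, subtracting an inner derivation makes it R_q with q in
    ker T.  On e_i this commutator has its image both in the e_i-line and in
    the image of T - c_i, so it vanishes and q = 0.  Now d commutes with T, so
    it scales each e_i, and comparing [d, R_p] with R_{d p} on the e_i shows
    that d kills ker T.  The weights of ker T on the e_i take arbitrary values,
    so a last inner derivation makes d vanish on the e_i as well, and then on
    all of R ([derivation_inner]). *)

Set Implicit Arguments.
Unset Strict Implicit.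
Unset Printing Implicit Defensive.

Import Order.TTheory GRing.Theory Num.Theory.
Local Open Scope ring_scope.

(** * Commutators and triangular matrices *)

Section Matrices.
Variable K : numFieldType.

(** Commuting with x is a derivation, and b commutes with a, so the usual
    chain rule holds. *)
Lemma horner_commutator n (a x b : 'M[K]_n.+1) (p : {poly K}) :
  a * x - x * a = b -> a * b = b * a ->
  horner_mx a p * x - x * horner_mx a p = horner_mx a p^`() * b.
Proof.
move=> abx ab; elim/poly_ind: p => [|p c IHp].
  by rewrite deriv0 !rmorph0 !mul0r mulr0 subr0.
have pb : horner_mx a p * b = b * horner_mx a p.
  exact/comm_horner_mx.
rewrite derivD derivM derivX derivC addr0 mulr1.
rewrite !rmorphD !rmorphM /= horner_mx_X horner_mx_C mulrDl mulrDr.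
rewrite -!mulmxE scalar_mxC !mulmxE opprD addrACA subrr addr0.
have -> : horner_mx a p * a * x - x * (horner_mx a p * a) =
  horner_mx a p * (a * x - x * a) + (horner_mx a p * x - x * horner_mx a p) * a.
  by rewrite mulrBr mulrBl !mulrA addrA subrK.
rewrite IHp mulrDl -!mulrA ab addrC; congr (_ * _ + _ * _).
exact: abx.
Qed.

(** Let p(a) b^q = 0; for p the characteristic polynomial of a and q = 0 this
    is the Cayley-Hamilton theorem.  Taking the commutator with x and
    multiplying by b^q on both sides gives p'(a) b^(2q+1) = 0.  Since the
    characteristic is 0, repeated differentiation ends with a nonzero constant
    polynomial. *)
Lemma commutator_nilpotent n (a x b : 'M[K]_n) :
  a *m x - x *m a = b -> a *m b = b *m a -> exists p, b ^+ p = 0.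
Proof.
case: n a x b => [|n] a x b abx ab; first by exists 0%N; apply/matrixP => -[].
suff H m : forall (p : {poly K}) q, (size p <= m)%N -> p != 0 ->
    horner_mx a p * b ^+ q = 0 -> exists r, b ^+ r = 0.
  apply: (H _ (char_poly a) 0%N (leqnn _)); last first.
    by rewrite expr0 mulr1; exact: Cayley_Hamilton.
  exact/monic_neq0/char_poly_monic.
elim: m => [|m IHm] p q; first by rewrite leqn0 size_poly_eq0 => /eqP -> /eqP.
move=> sp p0 pb0; have [s1|s1] := leqP (size p) 1.
  exists q; move: pb0; rewrite (size1_polyC s1) horner_mx_C => /eqP.
  rewrite -mulmxE mul_scalar_mx scaler_eq0 -polyC_eq0 -(size1_polyC s1).
  by rewrite (negPf p0) => /eqP.
apply: (IHm p^`() (q + q.+1)%N).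
- by rewrite -ltnS (leq_trans _ sp) // lt_size_deriv.
- apply: contraNneq p0 => /polyP/(_ (size p).-2); rewrite coef_deriv coef0.
  move/eqP; rewrite mulrn_eq0 /= -lead_coef_eq0 /lead_coef.
  by case: (size p) s1 => [|[]].
rewrite exprD exprSr.
have comb P : horner_mx a P * b ^+ q = b ^+ q * horner_mx a P.
  by apply/commrX/comm_horner_mx.
have cb : b ^+ q * b = b * b ^+ q by rewrite -exprSr exprS.
have -> : horner_mx a p^`() * (b ^+ q * (b ^+ q * b))
   = b ^+ q * (horner_mx a p * x - x * horner_mx a p) * b ^+ q.
  rewrite (horner_commutator p abx ab) !mulrA -comb -!mulrA.
  by congr (_ * (_ * _)).
by rewrite mulrBr mulrBl !mulrA -comb pb0 !mul0r add0r -!mulrA pb0 !mulr0 oppr0.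
Qed.

(** The eigenvalues of a triangular matrix are its diagonal entries; when these
    are distinct, choosing an eigenvector for each of them gives a basis, listed
    in the order of the diagonal. *)
Lemma trig_eigenbasis n (A : 'M[K]_n) : is_trig_mx A ->
  injective (fun i => A i i) ->
  exists2 V : 'M_n, V \in unitmx & V *m A = diag_mx (\row_i A i i) *m V.
Proof.
move=> tA injA.
have eigA i : exists v : 'rV_n, v *m A = A i i *: v /\ v != 0.
  have /eigenvalueP[v vA v0] : eigenvalue A (A i i); last by exists v.
  rewrite eigenvalue_root_char char_poly_trig // (bigD1 i) //=.
  by rewrite rootM root_XsubC eqxx.
have {eigA} [v /all_and2[vA v0]] := fin_all_exists eigA.
exists (\matrix_i v i); last first.
  by apply/row_matrixP => i; rewrite !row_mul row_diag_mx -scalemxAl -rowE rowK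
    mxE vA.
rewrite -row_free_unit -kermx_eq0; apply/rowV0P => u /sub_kermxP uV.
have dir : mxdirect (\sum_i eigenspace A (A i i)).
  by apply: mxdirect_sum_eigenspace => i j _ _; apply: injA.
apply/rowP => i; rewrite mxE.
suff /eqP : u 0 i *: v i = 0 by rewrite scaler_eq0 (negPf (v0 i)) orbF => /eqP.
apply/eqP; rewrite -submx0 -(mxdirect_sumsP dir i isT) sub_capmx.
rewrite scalemx_sub /=; last exact/eigenspaceP.
move: uV; rewrite mulmx_sum_row (bigD1 i) //= rowK => /eqP.
rewrite addr_eq0 => /eqP ->; rewrite -scaleN1r scalemx_sub //.
apply: summx_sub_sums => j _; rewrite rowK scalemx_sub //; exact/eigenspaceP.
Qed.

Lemma trig_nilpotent n (A : 'M[K]_n) : is_trig_mx A ->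
  (forall i, A i i = 0) -> A ^+ n = 0.
Proof.
case: n A => [|n] A tA dA; first by apply/matrixP => -[].
have := Cayley_Hamilton A; rewrite char_poly_trig //.
rewrite (eq_bigr (fun=> 'X)) => [|i _]; last by rewrite dA subr0.
by rewrite prodr_const card_ord rmorphXn /= horner_mx_X.
Qed.

End Matrices.

(** * Lower central series and nilpotent subalgebras *)

Section LeibnizAlgebra.
Variables (K : numFieldType) (L : vectType K) (br : {bilinear L -> L -> L}).
Hypothesis leib : right_leibniz br.
Implicit Types (M N U V W : {vspace L}) (u v w x y z b : L) (s c : K).

(** The shift makes [lc U 0] the subspace U itself and skips the irregular index
    0 of the series; thus [lc U i] is U^(i+1). *)
Local Notation lc U i := (lower_central br U i.+1).

(** The operator R_x - s; for s = 0 it is R_x itself as an endomorphism, so that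
    the nilpotent case and the eigenvalue case share their lemmas. *)
Definition rmul_shift x s : 'End(L) := linfun (applyr br x) - s *: \1%VF.

Lemma rmul_shiftE x s u : rmul_shift x s u = br u x - s *: u.
Proof.
by rewrite /rmul_shift add_lfunE opp_lfunE scale_lfunE id_lfunE lfunE.
Qed.

Lemma rmul_shift0 x u : rmul_shift x 0 u = br u x.
Proof. by rewrite rmul_shiftE scale0r subr0. Qed.

(** Since R_x is a derivation, eigenvalues add up under the bracket. *)
Lemma rmul_shift_br x s c u v :
  rmul_shift x (s + c) (br u v)
  = br (rmul_shift x s u) v + br u (rmul_shift x c v).
Proof.
rewrite !rmul_shiftE leib linearBl linearBr linearZl_LR linearZr_LR /=.
by rewrite scalerDl opprD addrACA.
Qed.

Lemma br_br x y z : br x (br y z) = br (br x y) z - br (br x z) y.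
Proof. by rewrite leib addrC addrA addNr add0r. Qed.

Lemma bracketvS U V U' V' :
  (U <= U')%VS -> (V <= V')%VS -> (bracketv br U V <= bracketv br U' V')%VS.
Proof.
move=> /subvP sU /subvP sV; apply/bracketvP => u v Uu Vv.
by apply: memv_bracket; [apply: sU | apply: sV].
Qed.

Lemma bracketv_sub_preim U V W (f : 'End(L)) :
  {in U & V, forall u v, f (br u v) \in W} ->
  {in bracketv br U V, forall w, f w \in W}.
Proof.
move=> fW w; rewrite memv_preim; apply/subvP/bracketvP => u v Uu Vv.
by rewrite -memv_preim fW.
Qed.

Lemma lcS U i : lc U i.+1 = bracketv br (lc U i) U. Proof. by []. Qed.

Lemma lc_sub M i : (bracketv br M M <= M)%VS -> (lc M i.+1 <= lc M i)%VS.
Proof. by move=> MM; elim: i => [//|i IHi]; rewrite lcS bracketvS. Qed.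

Lemma lc_sub0 M i : (bracketv br M M <= M)%VS -> (lc M i <= M)%VS.
Proof.
by move=> MM; elim: i => [//|i IHi]; apply: subv_trans IHi; exact: lc_sub.
Qed.

Lemma lc_rmul M b i : {in M, forall u, br u b \in M} ->
  {in lc M i, forall u, br u b \in lc M i}.
Proof.
move=> Mb; elim: i => [//|i IHi] u; rewrite lcS -rmul_shift0.
move: u; apply: bracketv_sub_preim => u v iu Mv.
by rewrite rmul_shift0 leib memvD // memv_bracket ?IHi ?Mb.
Qed.

(** A bracket counts as two steps also on the right: by the Leibniz identity,
    [u, [v, w]] is a difference of two brackets iterated on the left. *)
Lemma lc_br2 M i u v :
  u \in lc M i -> v \in lc M 1 -> br u v \in lc M i.+2.
Proof.
move=> iu; have -> : br u v = linfun (br u) v by rewrite lfunE.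
move: v; apply: bracketv_sub_preim => v w Mv Mw.
by rewrite lfunE /= br_br memvB // !memv_bracket.
Qed.

(** Generalized eigenvectors modulo the next term of the series multiply, and
    their eigenvalues add up.  Expanding one factor at a time by
    [rmul_shift_br] replaces the binomial formula: each step lowers p or q, and
    when one of them is 0 the bracket already lies in the smaller term. *)
Lemma gen_eigen_br M b s c i p q u v :
  {in M, forall u, br u b \in M} -> u \in lc M i -> v \in M ->
  iter p (rmul_shift b s) u \in lc M i.+1 ->
  iter q (rmul_shift b c) v \in lc M 1 ->
  iter (p + q) (rmul_shift b (s + c)) (br u v) \in lc M i.+2.
Proof.
move=> Mb; elim: {p q}(p + q)%N {-2}p {-2}q (erefl (p + q)%N) u v =>
  [|m IHm] p q.
  case: p q => [|//] [|//] _ u v _ Mv /= iu _; exact: memv_bracket.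
have stab j e w : w \in lc M j -> rmul_shift b e w \in lc M j.
  by move=> jw; rewrite rmul_shiftE memvB ?memvZ ?lc_rmul.
have iter_stab j e w n : w \in lc M j -> iter n (rmul_shift b e) w \in lc M j.
  by move=> jw; elim: n => //= n; apply: stab.
move=> pq u v iu Mv pu qv.
case: p pq pu => [_ iu1|p pq pu]; first exact/iter_stab/memv_bracket.
case: q pq qv => [_ v1|q pq qv]; first exact/iter_stab/lc_br2.
rewrite pq iterSr rmul_shift_br.
have iterD n (f : 'End(L)) : {morph iter n f : x y / x + y}.
  by elim: n => //= n IHn x y; rewrite /= IHn linearD.
rewrite iterD memvD //.
- have <- : (p + q.+1 = m)%N by apply/eqP; rewrite -eqSS -pq addSn.
  apply: IHm => //; last by rewrite -iterSr.
  + by apply/eqP; rewrite -eqSS -pq addSn.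
  + exact: stab.
- have mE : (p.+1 + q = m)%N by apply/eqP; rewrite -eqSS -pq addnS.
  rewrite -mE; apply: IHm => //; last by rewrite -iterSr.
  exact: (stab 0).
Qed.

(** Nilpotency on M modulo [M, M] propagates to every quotient of the lower
    central series, by [gen_eigen_br] with both eigenvalues 0. *)
Lemma nilpotent_rmul M b p : nilpotentv br M ->
  {in M, forall u, br u b \in M} ->
  {in M, forall u, iter p (rmul_shift b 0) u \in lc M 1} ->
  exists q, {in M, forall u, iter q (rmul_shift b 0) u = 0}.
Proof.
move=> [n nM] Mb pM.
have {}nM : lc M n.-1 = 0%VS by case: n nM.
have step i :
    exists q, {in lc M i, forall u, iter q (rmul_shift b 0) u \in lc M i.+1}.
  elim: i => [|i [q IHi]]; first by exists p.
  exists (q + p)%N => u iu.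
  have iter_lfun (k : nat) : exists f : 'End(L), iter k (rmul_shift b 0) =1 f.
    elim: k => [|k [f fE]]; first by exists \1%VF => x /=; rewrite id_lfunE.
    by exists (rmul_shift b 0 \o f)%VF => x /=; rewrite comp_lfunE fE.
  have [f fE] := iter_lfun (q + p)%N; rewrite fE; move: u iu.
  apply: bracketv_sub_preim => u v iu Mv; rewrite -fE.
  rewrite -[X in rmul_shift b X](addr0 0); apply: gen_eigen_br => //.
    exact: IHi.
  exact: pM.
have all i : exists q, {in M, forall u, iter q (rmul_shift b 0) u \in lc M i}.
  elim: i => [|i [q IHi]]; first by exists 0%N.
  have [r rP] := step i; exists (r + q)%N => u Mu.
  by rewrite iterD; apply/rP/IHi.
have [q qP] := all n.-1; exists q => u Mu; apply/eqP; rewrite -memv0 -nM.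
exact: qP.
Qed.

(** In the lower central series of M + <b>, each bracket with M leads one step
    down in the series of M, while p brackets with b annihilate M; so every
    term of the series of M is reached. *)
Lemma nilpotent_ext M b p : (bracketv br M M <= M)%VS -> nilpotentv br M ->
  {in M, forall u, br u b \in M} -> {in M, forall u, br b u \in M} ->
  br b b \in M -> {in M, forall u, iter p (rmul_shift b 0) u = 0} ->
  nilpotentv br (M + <[b]>)%VS.
Proof.
move=> MM [n nM] Mb bM bb pM; set I := (M + _)%VS.
have {}nM : lc M n.-1 = 0%VS by case: n nM.
have MI : (M <= I)%VS by exact: addvSl.
have bI : b \in I by apply: (subvP (addvSr _ _)); exact: memv_line.
(* Two elements of I bracket into M, so the series of I starts with q = 1. *)
have II : (bracketv br I I <= M)%VS.
  apply/bracketvP => x y /memv_addP[u Mu [_ /vlineP[s ->] ->]].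
  move=> /memv_addP[v Mv [_ /vlineP[c ->] ->]].
  rewrite linearDl !linearDr !linearZl_LR /= !linearZr_LR /=.
  have /bracketvP MMv := MM.
  by rewrite !(memvD, memvZ) ?bb ?Mb ?bM ?MMv.
have step i : exists q, (lc I q <= lc M i)%VS.
  elim: i => [|i [q IHi]]; first by exists 1%N; exact: II.
  exists (q + p)%N.
  (* Brackets that involve M go to the second summand, where they stay; only
     pure powers of R_b are left in the first one. *)
  have H j : (lc I (q + j)
     <= (iter j (fun V => rmul_shift b 0 @: V) (lc M i) + lc M i.+1))%VS.
    elim: j => [|j IHj]; first by rewrite addn0; exact: subv_trans (addvSl _ _).
    set X := iter j _ _ in IHj *.
    have XM : (X <= lc M i)%VS.
      rewrite /X; elim: (j) => //= k /subvP IHk.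
      apply/subvP => _ /memv_imgP[u /IHk uk ->].
      by rewrite rmul_shift0 lc_rmul.
    rewrite addnS lcS; apply/bracketvP => u w.
    move=> /(subvP IHj)/memv_addP[x Xx [y iy ->]].
    move=> /memv_addP[v Mv [_ /vlineP[c ->] ->]].
    rewrite linearDr linearZr_LR /= linearDl memvD //.
      apply: (subvP (addvSr _ _)); rewrite memvD //.
        by apply: memv_bracket => //; exact: (subvP XM).
      apply: (subvP (lc_sub i.+1 MM)).
      exact: memv_bracket.
    rewrite linearDl memvZ // memvD //.
      apply: (subvP (addvSl _ _)); rewrite -rmul_shift0; exact: memv_img.
    by apply: (subvP (addvSr _ _)); exact: lc_rmul.
  apply: (subv_trans (H p)); rewrite -[X in (_ <= X)%VS]add0v addvS //.
  have : {in lc M i, forall u, iter p (rmul_shift b 0) u = 0}.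
    by move=> u iu; apply: pM; apply: (subvP (lc_sub0 i MM)).
  elim: (p) (lc M i) => [|k IHk] X kX /=.
    by apply/subvP => u /kX /= ->; exact: mem0v.
  rewrite -iterS iterSr; apply: IHk => _ /memv_imgP[u Xu ->].
  by rewrite -iterSr kX.
have [q qP] := step n.-1; exists q.+1; apply/eqP; rewrite -subv0.
by rewrite -nM.
Qed.

End LeibnizAlgebra.

(** * Coordinates on a quotient of subspaces *)

Section Coordinates.
Variables (K : fieldType) (L : vectType K).
Implicit Types U W : {vspace L}.

Section Maps.
Variables (k : nat) (e : k.-tuple L) (f : 'End(L)).

Definition tuple_coord (u : L) : 'rV[K]_k := \row_j coord e j (f u).

Fact tuple_coord_linear : linear tuple_coord.
Proof. by move=> s u v; apply/rowP => j; rewrite !mxE !linearP. Qed.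

HB.instance Definition _ :=
  GRing.isLinear.Build K L 'rV[K]_k _ tuple_coord tuple_coord_linear.

Definition tuple_comb (v : 'rV[K]_k) : L := \sum_j v 0 j *: e`_j.

Fact tuple_comb_linear : linear tuple_comb.
Proof.
move=> s u v; rewrite scaler_sumr -big_split; apply: eq_bigr => j _ /=.
by rewrite !mxE scalerDl scalerA.
Qed.

HB.instance Definition _ :=
  GRing.isLinear.Build K 'rV[K]_k L _ tuple_comb tuple_comb_linear.

End Maps.

(** The map [pi] restricted to U is the projection to U / W followed by
    coordinates, and [iota] lifts coordinate vectors back to U. *)
Lemma quotient_coord U W k : (W <= U)%VS -> k = dim_quot U W ->
  exists (pi : 'Hom(L, 'rV[K]_k)) (iota : 'Hom('rV[K]_k, L)),
  [/\ forall v, iota v \in U, cancel iota pi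
    & {in U, forall u, (pi u == 0) = (u \in W)}].
Proof.
move=> WU ->; set k' := dim_quot U W; pose C := (U :\: W)%VS.
have dimC : \dim C = k'.
  rewrite /k' /dim_quot -(dimv_cap_compl U W) (capvC U W) (capv_idPl WU).
  by rewrite addKn.
have CW : (C :&: W = 0)%VS by exact: capv_diff.
case: _ / dimC; exists (linfun (tuple_coord (vbasis C) (daddv_pi C W))).
exists (linfun (tuple_comb (vbasis C))).
have CU : (C <= U)%VS by exact: diffvSl.
have combC v : tuple_comb (vbasis C) v \in C.
  apply: memv_suml => j _; rewrite memvZ // vbasis_mem // mem_nth //.
  by rewrite size_tuple.
split=> [v|v|u Uu].
- by rewrite lfunE /=; exact: (subvP CU).
- rewrite !lfunE /=; apply/rowP => j; rewrite mxE daddv_pi_id //.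
  by rewrite coord_sum_free // (basis_free (vbasisP C)).
have UCW : u \in (C + W)%VS by rewrite addv_diff (subvP (addvSl _ _)).
rewrite lfunE /=; apply/eqP/idP => [u0|Wu].
  rewrite -(daddv_pi_add CW UCW) (coord_vbasis (memv_pi C W u)) big1 => [|j _].
    by rewrite add0r memv_pi.
  by move/rowP: u0 => /(_ j); rewrite !mxE => ->; rewrite scale0r.
have := daddv_pi_add CW UCW; rewrite (daddv_pi_id _ Wu) 1?capvC //.
move=> /(canRL (addrK _)); rewrite subrr => pi0.
by apply/rowP => j; rewrite !mxE pi0 linear0.
Qed.

End Coordinates.

(** * The derived algebra lies in the nilradical *)

Section ActionModSquare.
Variables (K : numFieldType) (L : vectType K) (br : {bilinear L -> L -> L}).
Hypothesis leib : right_leibniz br.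
Implicit Types (U V : {vspace L}) (u v x y z a b : L) (S : seq L).

Local Notation lc U i := (lower_central br U i.+1).
Local Notation ds j := (derived_series br fullv j.+1).

Lemma idealvP (I : {vspace L}) :
  idealv br I <-> {in I, forall u x, br u x \in I /\ br x u \in I}.
Proof.
split=> [[/bracketvP Il /bracketvP Ir] u Iu x | H].
  by rewrite Il ?Ir ?memvf.
by split; apply/bracketvP => u v Uu Vv; [case: (H u Uu v) | case: (H v Vv u)].
Qed.

Lemma derived_ideal j : idealv br (ds j).
Proof.
elim: j => [|j /idealvP IHj]; first by split; exact: subvf.
apply/idealvP => w Dw x; split.
  rewrite -rmul_shift0; move: w Dw; apply: bracketv_sub_preim => u v Du Dv.
  have [[uD _] [vD _]] := (IHj u Du x, IHj v Dv x).
  by rewrite rmul_shift0 leib memvD // memv_bracket.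
have -> : br x w = linfun (br x) w by rewrite lfunE.
move: w Dw; apply: bracketv_sub_preim => u v Du Dv.
have [[_ uD] [_ vD]] := (IHj u Du x, IHj v Dv x).
by rewrite lfunE /= br_br // memvB // memv_bracket.
Qed.

Variable N : {vspace L}.
Hypothesis Nideal : idealv br N.
Hypothesis Nnil : nilpotentv br N.
Hypothesis Nmax : forall I, idealv br I -> nilpotentv br I -> (I <= N)%VS.

Variables (k : nat) (pi : 'Hom(L, 'rV[K]_k)) (iota : 'Hom('rV[K]_k, L)).
Hypothesis iotaN : forall v : 'rV[K]_k, iota v \in N.
Hypothesis piK : cancel iota pi.
Hypothesis piE : {in N, forall u, (pi u == 0) = (u \in lc N 1)}.

Let NL u x : u \in N -> br u x \in N.
Proof. by move=> Nu; case: ((idealvP N).1 Nideal u Nu x). Qed.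

Let LN u x : u \in N -> br x u \in N.
Proof. by move=> Nu; case: ((idealvP N).1 Nideal u Nu x). Qed.

Let NN : (bracketv br N N <= N)%VS.
Proof. by apply/bracketvP => u v Nu _; exact: NL. Qed.

(** The action of x by right multiplication on N / N^2.  On row vectors a right
    Leibniz bracket becomes the commutator of matrices without a change of
    sign, see [rho_br]. *)
Definition rho x : 'M[K]_k := \matrix_i pi (br (iota (delta_mx 0 i)) x).

Lemma rho_iota (v : 'rV[K]_k) x : v *m rho x = pi (br (iota v) x).
Proof.
rewrite mulmx_sum_row [in RHS](row_sum_delta v) !linear_sum linear_sumlz.
rewrite linear_sum; apply: eq_bigr => i _.
by rewrite rowK !linearZ linearZl_LR linearZ.
Qed.

Lemma pi_br u x : u \in N -> pi (br u x) = pi u *m rho x.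
Proof.
move=> Nu; rewrite rho_iota; apply/eqP; rewrite -subr_eq0 -linearB -linearBl.
have Nd : u - iota (pi u) \in N by rewrite memvB.
rewrite piE ?NL // lc_rmul // => [w Nw|]; first exact: NL.
by rewrite -piE // linearB /= piK subrr.
Qed.

Lemma eq_mx_mulrow A B :
  (forall v : 'rV[K]_k, v *m A = v *m B :> 'rV[K]_k) -> A = B.
Proof. by move=> AB; apply/row_matrixP => i; rewrite !rowE. Qed.

Lemma rho_br x y : rho (br x y) = rho x *m rho y - rho y *m rho x.
Proof.
apply: eq_mx_mulrow => v; rewrite mulmxBr !mulmxA rho_iota br_br // linearB /=.
by rewrite !pi_br ?NL // piK.
Qed.

Lemma rho_linear : linear rho.
Proof.
move=> s x y; apply: eq_mx_mulrow => v.
by rewrite mulmxDr -scalemxAr !rho_iota linearDr linearZr_LR linearP.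
Qed.
HB.instance Definition _ := GRing.isLinear.Build K L 'M[K]_k _ rho rho_linear.

Lemma rho_N x : x \in N -> rho x = 0.
Proof.
move=> Nx; apply: eq_mx_mulrow => v; rewrite rho_iota mulmx0; apply/eqP.
by rewrite piE ?NL // memv_bracket.
Qed.

Lemma rho_nilpotent b p : rho b ^+ p = 0 ->
  {in N, forall u, iter p (rmul_shift br b 0) u \in lc N 1}.
Proof.
move=> bp u Nu.
have [Ni pi_iter] : iter p (rmul_shift br b 0) u \in N /\
    pi (iter p (rmul_shift br b 0) u) = pi u *m (rho b ^+ p).
  elim: p {bp} => [|p [IHN IHpi]]; first by rewrite expr0 mulmx1.
  by rewrite iterS rmul_shift0 NL // pi_br // IHpi exprSr mulmxA.
by rewrite -piE // pi_iter bp mulmx0.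
Qed.

(** The elements of S are adjoined to N one after the other.  At each stage N
    has been extended to a nilpotent subalgebra M with [M, b] and [b, M] inside
    N, so R_b is still nilpotent on M and [nilpotent_ext] applies.  Only the
    last stage has to be an ideal. *)
Lemma nilpotent_absorb S :
  {in S, forall b, exists p, rho b ^+ p = 0} ->
  {in S &, forall a b, br a b \in N} ->
  idealv br (N + <<S>>) -> (<<S>> <= N)%VS.
Proof.
move=> Snil SS idS; apply: subv_trans (addvSr N _) _; apply: Nmax => //.
suff: forall S', {subset S' <= S} ->
    {in (N + <<S'>>)%VS,
      forall u, {in S, forall b, br u b \in N /\ br b u \in N}}
    /\ nilpotentv br (N + <<S'>>).
  by case/(_ S (fun _ => id)).
elim=> [|b S' IH] sub.
  by rewrite span_nil addv0; split=> // u Nu a _; rewrite NL ?LN.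
have Sb : b \in S by rewrite sub ?mem_head.
have /IH[MN Mnil] : {subset S' <= S}.
  by move=> a aS'; rewrite sub // inE aS' orbT.
rewrite span_cons (addvC <[b]>%VS) addvA; set M := (N + <<S'>>)%VS in MN Mnil *.
have NM : (N <= M)%VS by exact: addvSl.
split=> [_ /memv_addP[u Mu [_ /vlineP[s ->] ->]] a Sa|].
  have [ua au] := MN u Mu a Sa.
  rewrite linearDl linearDr linearZl_LR linearZr_LR.
  by split; rewrite /= memvD // memvZ // SS.
have [p bp] := Snil b Sb.
have Nb : {in N, forall u, br u b \in N} by move=> u; exact: NL.
have [q qN] := nilpotent_rmul leib Nnil Nb (rho_nilpotent bp).
apply: (@nilpotent_ext _ _ _ leib M b q.+1) => //.
- apply: subv_trans NM.
  have MS : (M <= N + <<S>>)%VS.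
    by rewrite addvS //; apply: sub_span => a aS'; rewrite sub // inE aS' orbT.
  apply/bracketvP => u v Mu Mv.
  have -> : br u v = linfun (br u) v by rewrite lfunE.
  rewrite memv_preim; move: v Mv; apply/subvP; rewrite subv_add.
  apply/andP; split; first by apply/subvP => v Nv; rewrite -memv_preim lfunE LN.
  apply/span_subvP => v S'v; rewrite -memv_preim lfunE /=.
  by have [] := MN u Mu v; rewrite ?sub // inE S'v orbT.
- by move=> u Mu; apply: (subvP NM); case: (MN u Mu b Sb).
- by move=> u Mu; apply: (subvP NM); case: (MN u Mu b Sb).
- by apply: (subvP NM); exact: SS.
by move=> u Mu; rewrite iterSr qN // rmul_shift0; case: (MN u Mu b Sb).
Qed.

Lemma rho_commutator_nilpotent a x :
  rho a *m rho (br a x) = rho (br a x) *m rho a ->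
  exists p, rho (br a x) ^+ p = 0.
Proof. by apply: commutator_nilpotent; rewrite rho_br. Qed.

Lemma rho_brC x a : rho (br x a) = - rho (br a x).
Proof. by rewrite !rho_br opprB. Qed.

(** Let D be the term to be absorbed.  Modulo N it is abelian, so for a in D and
    any x the bracket [a, x] commutes with a on N / N^2, hence acts
    nilpotently; so [D, L] + [L, D] lies in N.  But D is spanned by brackets
    [y, z], and now these commute with y on N / N^2 and act nilpotently too. *)
Lemma derived_absorb j : (ds j.+2 <= N)%VS -> (ds j.+1 <= N)%VS.
Proof.
move=> /subvP D2N; set D := ds j.+1.
have /idealvP Did := derived_ideal j.+1.
have DDN : {in D &, forall a b, br a b \in N}.
  by move=> a b Da Db; rewrite D2N // memv_bracket.
have step S : {in S, forall b, exists p, rho b ^+ p = 0} -> {subset S <= D} ->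
    idealv br (N + <<S>>) -> (<<S>> <= N)%VS.
  move=> Snil SD; apply: nilpotent_absorb => // a b Sa Sb.
  by apply: DDN; exact: SD.
have commN a b : br a b \in N -> rho a *m rho b = rho b *m rho a.
  by move=> /rho_N; rewrite rho_br => /subr0_eq.
(* Both orders of the bracket are needed for E to be a two-sided ideal. *)
pose E := (bracketv br D fullv + bracketv br fullv D)%VS.
have EN : (E <= N)%VS.
  rewrite /E /bracketv -span_cat; set S := _ ++ _.
  have SE : <<S>>%VS = E by rewrite span_cat.
  have SD a x : a \in D -> exists p, rho (br a x) ^+ p = 0.
    move=> Da; apply/rho_commutator_nilpotent/commN/DDN => //.
    by case: (Did a Da x).
  apply: step.
  - move=> b; rewrite mem_cat => /orP[] /allpairsP[[u v] /= [Uu Vv ->]].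
      by apply: SD; rewrite vbasis_mem.
    have [p up] := SD v u (vbasis_mem Vv); exists p.
    by rewrite rho_brC exprNn up mulr0.
  - move=> b; rewrite mem_cat => /orP[] /allpairsP[[u v] /= [Uu Vv ->]].
      by case: (Did u (vbasis_mem Uu) v).
    by case: (Did v (vbasis_mem Vv) u).
  rewrite SE; apply/idealvP => _ /memv_addP[n Nn [e Ee ->]] x.
  have De : e \in D.
    apply: (subvP _ _ Ee); rewrite subv_add.
    by apply/andP; split; apply/bracketvP => u v Uu Vv;
      [case: (Did u Uu v) | case: (Did v Vv u)].
  rewrite linearDl linearDr; split; apply: memv_add;
    [exact: NL | | exact: LN |].
    by apply: (subvP (addvSl _ _)); rewrite memv_bracket ?memvf.
  by apply: (subvP (addvSr _ _)); rewrite memv_bracket ?memvf.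
have DLN a x : a \in D -> br a x \in N.
  move=> Da; apply: (subvP EN); apply: (subvP (addvSl _ _)).
  by rewrite memv_bracket ?memvf.
have LDN a x : a \in D -> br x a \in N.
  move=> Da; apply: (subvP EN); apply: (subvP (addvSr _ _)).
  by rewrite memv_bracket ?memvf.
apply: step.
- move=> _ /allpairsP[[y z] /= [Dy Dz ->]].
  apply/rho_commutator_nilpotent/commN/LDN.
  by apply: memv_bracket; exact: vbasis_mem.
- move=> _ /allpairsP[[y z] /= [Dy Dz ->]].
  by apply: memv_bracket; exact: vbasis_mem.
apply/idealvP => _ /memv_addP[n Nn [e De ->]] x.
rewrite linearDl linearDr; split; apply: (subvP (addvSl _ _)).
  by apply: memvD; [exact: NL | exact: DLN].
by apply: memvD; [exact: LN | exact: LDN].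
Qed.

Hypothesis Lsolv : solvablev br {:L}.

Lemma derived_sub_nilradical x y : br x y \in N.
Proof.
suff /subvP : (ds 1 <= N)%VS by apply; rewrite /= memv_bracket ?memvf.
have [m Dm0] := Lsolv.
have: (ds m.-1.+1 <= N)%VS.
  have Dm : ds m.-1 = 0%VS by case: (m) Dm0.
  apply/bracketvP => u v Du _; suff /eqP -> : u == 0 by rewrite linear0l mem0v.
  by rewrite -memv0 -Dm.
by elim: m.-1 => // j IHj /derived_absorb.
Qed.

Lemma rho_nilpotent_mem x p : rho x ^+ p = 0 -> x \in N.
Proof.
move=> xp; have /subvP : (<<[:: x]>> <= N)%VS; last first.
  by apply; rewrite memv_span ?mem_head.
apply: nilpotent_absorb => [b|a b _ _|].
- by rewrite inE => /eqP ->; exists p.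
- exact: derived_sub_nilradical.
apply/idealvP => u _ y.
by split; apply: (subvP (addvSl _ _)); exact: derived_sub_nilradical.
Qed.

End ActionModSquare.

(** * An element with prescribed eigenvalues *)

Section SplitElement.
Variables (K : numClosedFieldType) (L : vectType K).
Variables (br : {bilinear L -> L -> L}) (Q : {vspace L}).
Local Notation k := (\dim Q).
Variable rho : {linear L -> 'M[K]_k}.
Hypothesis rho_comm : forall x y, rho x *m rho y = rho y *m rho x.
Hypothesis rho_nil : forall x p, x \in Q -> rho x ^+ p = 0 -> x = 0.

(** In a basis which triangularizes all [rho x], an x in Q with zero diagonal
    would act nilpotently.  So taking diagonals is injective on Q, hence
    bijective by dimension.  Distinct diagonal entries moreover make [rho x0]
    diagonalizable. *)
Lemma exists_split_element (c : 'I_k -> K) : injective c ->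
  exists x0, exists2 V : 'M_k, V \in unitmx &
    V *m rho x0 = diag_mx (\row_i c i) *m V.
Proof.
move=> injc; pose q := vbasis Q.
have [|P /unitarymx_unit Pu /allP Ptrig] :=
  @cotrigonalization _ _ [seq rho x | x <- q].
  by move=> _ _ /mapP[x _ ->] /mapP[y _ ->]; exact: rho_comm.
pose B x := P *m rho x *m invmx P.
pose comb (y : 'rV[K]_k) : L := \sum_j y 0 j *: q`_j.
have Bcomb y i l : B (comb y) i l = \sum_j y 0 j * B q`_j i l.
  rewrite /B /comb linear_sum mulmx_sumr mulmx_suml summxE.
  by apply: eq_bigr => j _; rewrite linearZ -scalemxAr -scalemxAl mxE.
have Btrig y : is_trig_mx (B (comb y)).
  apply/is_trig_mxP => i l il; rewrite Bcomb big1 // => j _.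
  have /Ptrig : rho q`_j \in [seq rho x | x <- q].
    by rewrite map_f // mem_nth // size_tuple.
  rewrite /= /similar_to /simmx_to_for conjumx // => /is_trig_mxP/(_ i l il).
  by rewrite -/(B _) => ->; rewrite mulr0.
(* The matrix of the map sending x in Q to the diagonal of B x. *)
pose M : 'M[K]_k := \matrix_(j, i) B q`_j i i.
have diagB y i : B (comb y) i i = (y *m M) 0 i.
  rewrite Bcomb [in RHS]mxE; apply: eq_bigr => j _; congr (_ * _).
  by rewrite [in RHS]mxE.
have Bexp x p : B x ^+ p = P *m (rho x ^+ p) *m invmx P.
  elim: p => [|p IHp]; first by rewrite !expr0 mulmx1 mulmxV.
  rewrite !exprSr IHp -!mulmxE /B !mulmxA mulmxKV //.
have Munit : M \in unitmx.
  rewrite -row_free_unit -kermx_eq0; apply/rowV0P => y /sub_kermxP yM.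
  have combQ : comb y \in Q.
    apply: memv_suml => j _; rewrite memvZ // vbasis_mem // mem_nth //.
    by rewrite size_tuple.
  have : B (comb y) ^+ k = 0.
    by apply: trig_nilpotent => // i; rewrite diagB yM mxE.
  rewrite Bexp => /(congr1 (fun A => invmx P *m A *m P)).
  rewrite mulmx0 mul0mx !mulmxA mulVmx // mul1mx mulmxKV // => /rho_nil.
  move=> /(_ combQ) comb0; apply/rowP => j; rewrite mxE.
  have /freeP freeQ := basis_free (vbasisP Q); exact: (freeQ (y 0) comb0 j).
pose x0 := comb ((\row_i c i) *m invmx M).
have dB i : B x0 i i = c i by rewrite diagB mulmxKV // mxE.
have [|V Vu VB] := @trig_eigenbasis _ _ (B x0) (Btrig _).
  by move=> i j; rewrite !dB => /injc.
exists x0, (V *m P); first by rewrite unitmx_mul Vu.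
have -> : \row_i c i = \row_i B x0 i i.
  by apply/rowP => i; rewrite mxE [RHS]mxE dB.
by rewrite mulmxA -VB /B !mulmxA mulmxKV.
Qed.

End SplitElement.

(** * Weight decomposition and derivations *)

Section InnerDerivations.
Variables (K : numFieldType) (L : vectType K) (br : {bilinear L -> L -> L}).
Hypothesis leib : right_leibniz br.
Implicit Types (X : {vspace L}) (u v w x y q : L) (s t : K) (d f : 'End(L)).

Local Notation lc U i := (lower_central br U i.+1).

Lemma rmul_derivation y : derivation br (rmul_shift br y 0).
Proof. by move=> u v; rewrite !rmul_shift0 leib. Qed.

Lemma derivationB d f :
  derivation br d -> derivation br f -> derivation br (d - f).
Proof.
move=> dd df u v; rewrite !add_lfunE !opp_lfunE dd df.
by rewrite linearBl linearBr opprD addrACA.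
Qed.

Variable N : {vspace L}.
Hypothesis Nnil : nilpotentv br N.
Hypothesis LLN : forall x y, br x y \in N.

Variables (k : nat) (pi : 'Hom(L, 'rV[K]_k)) (iota : 'Hom('rV[K]_k, L)).
Hypothesis iotaN : forall v : 'rV[K]_k, iota v \in N.
Hypothesis piK : cancel iota pi.
Hypothesis piE : {in N, forall u, (pi u == 0) = (u \in lc N 1)}.
Local Notation rho := (rho br pi iota).
Hypothesis rho_nil : forall x p, rho x ^+ p = 0 -> x \in N.
Hypothesis dimN : (\dim N + k = \dim {:L})%N.

(** The values k+1, ..., 2k are distinct, and a sum of two or more of them never
    is one of them again; neither is it 0. *)
Let weight (i : 'I_k) : K := (k.+1 + i)%:R.
Variables (x0 : L) (V : 'M[K]_k).
Hypothesis Vunit : V \in unitmx.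
Hypothesis Veigen : V *m rho x0 = diag_mx (\row_i weight i) *m V.
Local Notation T s := (rmul_shift br x0 s).

Let Nideal : idealv br N.
Proof. by apply/idealvP => u _ x. Qed.

Let NN : (bracketv br N N <= N)%VS.
Proof. by apply/bracketvP => u v _ _. Qed.

Let piN u x : u \in N -> pi (br u x) = pi u *m rho x.
Proof. exact: pi_br. Qed.

Let shift_stable i s : {in lc N i, forall u, T s u \in lc N i}.
Proof. by move=> u iu; rewrite rmul_shiftE memvB ?memvZ ?lc_rmul. Qed.

Let row_eigen i : row i V *m rho x0 = weight i *: row i V.
Proof. by rewrite -row_mul Veigen row_mul row_diag_mx -scalemxAl -rowE mxE. Qed.

(** On N^(i+1) / N^(i+2) all eigenvalues of R_x0 are natural numbers at least
    (i+1)(k+1), being sums of i+1 weights.  The span of the generalized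
    eigenvectors is expressed as the least subspace containing them, and p = 0
    puts the next term of the series into it. *)
Lemma gen_eigen_spans i X :
  (forall n p u, (i.+1 * k.+1 <= n)%N -> u \in lc N i ->
     iter p (T n%:R) u \in lc N i.+1 -> u \in X) ->
  (lc N i <= X)%VS.
Proof.
have base (Y : {vspace L}) : (forall n p u, (k.+1 <= n)%N -> u \in N ->
     iter p (T n%:R) u \in lc N 1 -> u \in Y) -> (N <= Y)%VS.
  move=> HY; apply/subvP => u Nu.
  rewrite -(subrK (iota (pi u)) u) memvD //.
    apply: (HY k.+1 0%N) => //; first by rewrite memvB.
    by rewrite -piE ?memvB // linearB /= piK subrr.
  rewrite -(mulmxKV Vunit (pi u)) mulmx_sum_row linear_sum memv_suml // => j _.
  rewrite linearZ memvZ //; apply: (HY (k.+1 + j)%N 1%N); rewrite ?leq_addr //=.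
  rewrite -piE; last by rewrite rmul_shiftE memvB ?memvZ.
  by rewrite rmul_shiftE linearB linearZ /= piN // piK row_eigen subrr.
elim: i X => [|i IHi] X HX; first by apply: base; rewrite mul1n in HX.
apply/bracketvP => u v iu Nv.
have -> : br u v = linfun (br u) v by rewrite lfunE.
rewrite memv_preim; move: v Nv; apply/subvP/base => m q v km Nv qv.
rewrite -memv_preim lfunE /= -rmul_shift0 memv_preim; move: u iu.
apply/subvP/IHi => n p u kn iu pu.
rewrite -memv_preim rmul_shift0; apply: (HX (n + m)%N (p + q)%N).
- by rewrite mulSn addnC leq_add.
- exact: memv_bracket.
by rewrite natrD; apply: gen_eigen_br.
Qed.

(** A number which is no eigenvalue on any quotient of the series from N^(i+1)
    on is no eigenvalue on N^(i+1). *)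
Lemma shift_surj i s : (forall n, (i.+1 * k.+1 <= n)%N -> n%:R != s) ->
  (lc N i <= T s @: lc N i)%VS.
Proof.
move=> ns.
(* If (T - n)^p u is reached, then so is u, by induction on p, because
   u = ((T - s) u - (T - n) u) / (n - s). *)
have step j : (i <= j)%N -> (lc N j <= T s @: lc N j + lc N j.+1)%VS.
  move=> ij; apply: gen_eigen_spans => n p u jn.
  have {ns}ns : n%:R - s != 0.
    by rewrite subr_eq0 ns // (leq_trans _ jn) // leq_mul2r ltnS ij.
  elim: p u => [|p IHp] u ju pu; first exact: (subvP (addvSr _ _)).
  have {IHp} u'X : T n%:R u \in (T s @: lc N j + lc N j.+1)%VS.
    by apply: IHp; rewrite ?shift_stable // -iterSr.
  have -> : u = (n%:R - s)^-1 *: (T s u - T n%:R u).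
    rewrite (_ : T s u - _ = (n%:R - s) *: u) ?scalerK //.
    by rewrite !rmul_shiftE opprB addrC addrA subrK scalerBl.
  by rewrite memvZ // memvB //; apply: (subvP (addvSl _ _)); exact: memv_img.
have lc_add m : (lc N (i + m) <= lc N i)%VS.
  elim: m => [|m IHm]; first by rewrite addn0.
  by rewrite addnS; apply: subv_trans IHm; exact: lc_sub.
have {step} all m : (lc N i <= T s @: lc N i + lc N (i + m))%VS.
  elim: m => [|m IHm]; first by rewrite addn0 addvSr.
  apply: subv_trans IHm _; rewrite subv_add addvSl /=.
  apply: subv_trans (step _ (leq_addr _ _)) _.
  by rewrite addnS addvS // limgS.
have [m Nm] := Nnil; have {}Nm : lc N m.-1 = 0%VS by case: m Nm.
have := all m.-1; have -> : lc N (i + m.-1) = 0%VS; last by rewrite addv0.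
apply/eqP; rewrite -subv0 -Nm addnC; elim: (i) => [|j IHj].
  by rewrite addn0.
by rewrite addnS; apply: subv_trans IHj; exact: lc_sub.
Qed.

Lemma shift_inj i s u : (forall n, (i.+1 * k.+1 <= n)%N -> n%:R != s) ->
  u \in lc N i -> T s u = 0 -> u = 0.
Proof.
move=> /shift_surj surj iu Tu0; apply/eqP; rewrite -memv0.
suff -> : 0%VS = (lc N i :&: lker (T s))%VS.
  by rewrite memv_cap iu memv_ker Tu0 eqxx.
apply/esym/eqP; rewrite -dimv_eq0 -(eqn_add2r (\dim (T s @: lc N i))).
rewrite limg_ker_dim add0n eqn_leq dimvS //=.
by rewrite dimvS //; apply/subvP => _ /memv_imgP[v iv ->]; exact: shift_stable.
Qed.

Let nat_neq0 n : (1 * k.+1 <= n)%N -> n%:R != 0 :> K.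
Proof. by rewrite mul1n pnatr_eq0; case: n. Qed.

Let nat_neq_weight i n : (2 * k.+1 <= n)%N -> n%:R != weight i.
Proof.
move=> kn; rewrite eqr_nat gtn_eqF // (leq_trans _ kn) //
  mul2n -addnn ltn_add2l.
by rewrite ltnS ltnW.
Qed.

Let weight_inj : injective weight.
Proof.
by move=> i j /eqP; rewrite eqr_nat eqn_add2l => /eqP; exact: val_inj.
Qed.

(** A lift of an eigenvector on N / N^2 is an eigenvector up to an error in N^2,
    where T minus the eigenvalue is invertible. *)
Lemma eigenvector_lift i :
  exists e, [/\ e \in N, pi e = row i V & br e x0 = weight i *: e].
Proof.
pose e0 := iota (row i V); have e0N : e0 \in N by exact: iotaN.
have : T (weight i) e0 \in lc N 1.
  rewrite -piE; last by rewrite rmul_shiftE memvB ?memvZ.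
  by rewrite rmul_shiftE linearB linearZ /= piN // piK row_eigen subrr.
move/(subvP (shift_surj (@nat_neq_weight i)))/memv_imgP => [w w1 Tw].
have Nw : w \in N by exact: (subvP (lc_sub0 1 NN)).
exists (e0 - w); split; first by rewrite memvB.
  rewrite linearB /= piK; suff /eqP -> : pi w == 0 by rewrite subr0.
  by rewrite piE.
apply/eqP; rewrite -subr_eq0 -rmul_shiftE linearB /= Tw.
by rewrite subrr.
Qed.

Variable e : 'I_k -> L.
Hypothesis eN : forall i, e i \in N.
Hypothesis pie : forall i, pi (e i) = row i V.
Hypothesis ex0 : forall i, br (e i) x0 = weight i *: e i.

Let weight_neq0 i : weight i != 0. Proof. by rewrite pnatr_eq0 addSn. Qed.

Let pi_coord u : pi u = \sum_j (pi u *m invmx V) 0 j *: row j V.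
Proof. by rewrite -mulmx_sum_row mulmxKV. Qed.

Let coord_x0 u j : u \in N ->
  (pi (br u x0) *m invmx V) 0 j = weight j * (pi u *m invmx V) 0 j.
Proof.
move=> Nu; rewrite piN // -{1}(mulmxKV Vunit (pi u)) -!mulmxA (mulmxA V) Veigen.
by rewrite mulmxK // mulmxA mul_mx_diag mxE [X in _ * X]mxE mulrC.
Qed.

(** The eigenvalue of e i occurs once on N / N^2 and nowhere else. *)
Lemma eigenspace_line i u : br u x0 = weight i *: u -> exists t, u = t *: e i.
Proof.
move=> ux0; have Nu : u \in N.
  by rewrite -[u](scalerK (weight_neq0 i)) -ux0 memvZ.
exists ((pi u *m invmx V) 0 i); apply/eqP; rewrite -subr_eq0; apply/eqP.
apply: (shift_inj (@nat_neq_weight i)).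
  rewrite -piE; last by rewrite memvB ?memvZ.
  rewrite linearB linearZ /= pie subr_eq0 {1}pi_coord (bigD1 i) //=.
  rewrite big1 ?addr0 // => j ji.
  suff /eqP -> : (pi u *m invmx V) 0 j == 0 by rewrite scale0r.
  have := coord_x0 j Nu; rewrite ux0 linearZ -scalemxAl mxE => /eqP.
  rewrite -subr_eq0 -mulrBl mulf_eq0 subr_eq0 (inj_eq weight_inj).
  by rewrite eq_sym (negPf ji).
rewrite rmul_shiftE linearBl linearZl_LR /= ux0 ex0 scalerBr !scalerA.
by rewrite mulrC subrr.
Qed.

(** On N / N^2 the operator is diagonal, so no e i is hit: there are no Jordan
    blocks. *)
Lemma eigenvector_not_image i w t :
  br w x0 - weight i *: w = t *: e i -> t = 0.
Proof.
move=> wt; have Nw : w \in N.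
  rewrite -[w](scalerK (weight_neq0 i)) memvZ //.
  by rewrite -(subKr (br w x0) (weight i *: w)) wt memvB ?memvZ.
have := coord_x0 i Nw; rewrite -(subrK (weight i *: w) (br w x0)) wt.
rewrite linearD !linearZ /= pie mulmxDl -!scalemxAl mxE mxE [X in _ + X]mxE.
rewrite -[X in _ = X]add0r => /addIr; rewrite -row_mul mulmxV // mxE.
by rewrite mxE eqxx mulr1.
Qed.

(** The vectors e i span N modulo N^2, hence generate the nilpotent algebra N,
    and the kernel of a derivation is a subalgebra. *)
Lemma derivation_eq0 f : derivation br f -> (forall i, f (e i) = 0) ->
  {in N, forall u, f u = 0}.
Proof.
move=> df fe.
have base : (N <= (lker f :&: N) + lc N 1)%VS.
  apply/subvP => u Nu; pose w := \sum_j (pi u *m invmx V) 0 j *: e j.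
  have Nw : w \in N by apply: memv_suml => j _; rewrite memvZ.
  rewrite -(subrK w u) addrC memv_add //.
    rewrite memv_cap Nw memv_ker andbT linear_sum big1 // => j _.
    by rewrite linearZ /= fe scaler0.
  rewrite -piE ?memvB // linearB /= /w linear_sum subr_eq0.
  rewrite {1}(pi_coord u); apply/eqP.
  by apply: eq_bigr => j _; rewrite linearZ /= pie.
have step i : (lc N i <= (lker f :&: lc N i) + lc N i.+1)%VS.
  elim: i => [//|i IHi]; apply/bracketvP => u v.
  move=> /(subvP IHi)/memv_addP[a + [b ib ->]].
  rewrite memv_cap memv_ker => /andP[/eqP fa ia].
  move=> /(subvP base)/memv_addP[c + [w w1 ->]].
  rewrite memv_cap memv_ker => /andP[/eqP fc Nc].
  have Nw : w \in N by exact: (subvP (lc_sub0 1 NN)).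
  rewrite linearDr linearDl -addrA memv_add //.
    rewrite memv_cap memv_ker df fa fc linear0l linear0r addr0 eqxx.
    exact: memv_bracket.
  rewrite memvD //; first exact: memv_bracket.
  by rewrite linearDl memvD //; [exact: lc_br2 | exact: memv_bracket].
have all i : (N <= lker f + lc N i)%VS.
  elim: i => [|i IHi]; first exact: addvSr.
  apply: subv_trans IHi _; rewrite subv_add addvSl /=.
  by apply: subv_trans (step i) _; rewrite addvS // capvSl.
have [m Nm] := Nnil; have {}Nm : lc N m.-1 = 0%VS by case: m Nm.
have := all m.-1; rewrite Nm addv0 => /subvP Nf u /Nf.
by rewrite memv_ker => /eqP.
Qed.

(** Killing all e i, the operator R_q is zero on N / N^2, so q lies in the
    nilradical, where R_x0 is injective. *)
Lemma centralizer_eq0 q : br q x0 = 0 -> (forall i, br (e i) q = 0) -> q = 0.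
Proof.
move=> qx0 eq0; apply: (@shift_inj 0 0) => //; last by rewrite rmul_shift0.
apply: (@rho_nil _ 1); rewrite expr1 -[rho q](mulKmx Vunit).
suff -> : V *m rho q = 0 by rewrite mulmx0.
by apply/row_matrixP => i; rewrite row_mul -pie -piN // eq0 linear0 row0.
Qed.

(** The complement of N adapted to x0. *)
Local Notation Q := (lker (T 0)).

Let memQ q : (q \in Q) = (br q x0 == 0).
Proof. by rewrite memv_ker rmul_shift0. Qed.

Lemma Q_decomp u : exists q n, [/\ u = q + n, q \in Q & n \in N].
Proof.
have : T 0 u \in N by rewrite rmul_shift0.
move/(subvP (@shift_surj 0 0 nat_neq0))/memv_imgP => [n Nn Tu].
by exists (u - n), n; rewrite subrK memv_ker linearB /= Tu subrr.
Qed.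

Lemma dim_Q : \dim Q = k.
Proof.
apply/eqP; rewrite -(eqn_add2l (\dim N)) dimN.
rewrite -(limg_ker_dim (T 0) fullv) capfv addnC.
rewrite eqn_add2l; apply/eqP; congr (\dim _); apply/eqP; rewrite eqEsubv.
apply/andP; split.
  apply: subv_trans (shift_surj nat_neq0) _.
  by rewrite limgS // subvf.
by apply/subvP => _ /memv_imgP[u _ ->]; rewrite rmul_shift0.
Qed.

(** The kernel of the derivation R_x0 is a subalgebra, and it meets N trivially,
    while all brackets lie in N. *)
Lemma Q_abelian : {in Q &, forall p q, br p q = 0}.
Proof.
move=> p q; rewrite !memQ => /eqP p0 /eqP q0; apply: (@shift_inj 0 0) => //.
by rewrite rmul_shift0 leib p0 q0 linear0l linear0r addr0.
Qed.

Lemma Q_eigen i q : q \in Q -> exists t, br (e i) q = t *: e i.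
Proof.
rewrite memQ => /eqP q0; apply: eigenspace_line.
by rewrite leib [br q x0]q0 linear0r addr0 ex0 linearZl_LR.
Qed.

(** The weights of Q on the e i form an injective linear map by
    [centralizer_eq0], between spaces of the same dimension k. *)
Lemma Q_weights_onto (t : 'I_k -> K) :
  exists2 h, h \in Q & forall i, br (e i) h = t i *: e i.
Proof.
pose q (j : 'I_(\dim Q)) := (vbasis Q)`_j.
have qQ j : q j \in Q by rewrite vbasis_mem // mem_nth // size_tuple.
have /fin_all_exists[M Mq] (j : 'I_(\dim Q)) :
    exists m : 'I_k -> K, forall i, br (e i) (q j) = m i *: e i.
  by have /fin_all_exists := fun i => Q_eigen i (qQ j).
pose A : 'M_(\dim Q, k) := \matrix_(j, i) M j i.
have combE (y : 'rV_(\dim Q)) i :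
    br (e i) (\sum_j y 0 j *: q j) = (y *m A) 0 i *: e i.
  rewrite linear_sumr mxE scaler_suml; apply: eq_bigr => j _.
  by rewrite linearZr_LR /= Mq mxE scalerA.
have combQ (y : 'rV_(\dim Q)) : \sum_j y 0 j *: q j \in Q.
  by apply: memv_suml => j _; rewrite memvZ.
have Afree : row_free A.
  rewrite -kermx_eq0; apply/rowV0P => y /sub_kermxP yA.
  apply/rowP => j; rewrite mxE.
  have /freeP freeQ := basis_free (vbasisP Q); apply: (freeQ (y 0)).
  apply: centralizer_eq0 => [|i]; first by apply/eqP; rewrite -memQ.
  by rewrite combE yA mxE scale0r.
have Afull : row_full A by rewrite /row_full (eqP Afree) dim_Q.
have /submxP[y yA] := submx_full (\row_i t i) Afull.
by exists (\sum_j y 0 j *: q j) => // i; rewrite combE -yA mxE.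
Qed.

Lemma derivation_inner d : derivation br d -> inner_derivation br d.
Proof.
move=> dd; have [q [n [dx0 qQ Nn]]] := Q_decomp (d x0).
have /memv_imgP[y Ny nE] := subvP (@shift_surj 0 0 nat_neq0) n Nn.
have /eqP q0 : br q x0 == 0 by rewrite -memQ.
(* The part n = T y of d x0 is removed with the help of [x0, y], which acts as
   - [y, x0] = - n; hence the sign of y. *)
pose f := d - rmul_shift br (- y) 0.
have df : derivation br f by exact/derivationB/rmul_derivation.
have fT u : f (br u x0) = br (f u) x0 + br u q.
  rewrite /f !add_lfunE !opp_lfunE !rmul_shift0 !linearNr !opprK dd dx0 nE.
  rewrite rmul_shift0 linearDr linearDl (leib u y x0) -!addrA; congr (_ + _).
  by rewrite addrCA [RHS]addrC -!addrA; congr (_ + _); rewrite addrC.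
(* The commutator with T moves e i inside its own line, which meets the image
   of T minus its eigenvalue trivially. *)
have q_eq0 : q = 0.
  apply: centralizer_eq0 => // i; have [t et] := Q_eigen i qQ.
  have := fT (e i); rewrite ex0 linearZ /= et => fe.
  have /eigenvector_not_image/eqP :
      br (f (e i)) x0 - weight i *: f (e i) = - t *: e i.
    by rewrite fe opprD addrA subrr add0r scaleNr.
  by rewrite oppr_eq0 => /eqP ->; rewrite scale0r.
have {}fT u : f (br u x0) = br (f u) x0 by rewrite fT q_eq0 linear0r addr0.
have /fin_all_exists[t ft] i : exists t, f (e i) = t *: e i.
  by apply: eigenspace_line; rewrite -fT ex0 linearZ.
(* On e i both f and R_p act by scalars, so their commutator
   R_(f p) kills it. *)
have fQ p : p \in Q -> f p = 0.
  move=> pQ; have /eqP p0 : br p x0 == 0 by rewrite -memQ.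
  apply: centralizer_eq0 => [|i]; first by rewrite -fT p0 linear0.
  have [s es] := Q_eigen i pQ; have := df (e i) p.
  rewrite es linearZ /= ft linearZl_LR /= es !scalerA mulrC => /eqP.
  by rewrite addrC -subr_eq subrr eq_sym => /eqP.
have [h hQ eh] := Q_weights_onto t.
pose g := f - rmul_shift br h 0.
have dg : derivation br g by exact/derivationB/rmul_derivation.
have gN : {in N, forall u, g u = 0}.
  apply: derivation_eq0 => // i.
  by rewrite /g add_lfunE opp_lfunE rmul_shift0 ft eh subrr.
exists (h - y) => u; have [p [m [-> pQ Nm]]] := Q_decomp u.
have gp : g p = 0.
  by rewrite /g add_lfunE opp_lfunE rmul_shift0 fQ // Q_abelian // subrr.
have : g (p + m) = 0 by rewrite linearD /= gp gN // addr0.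
rewrite /g /f !add_lfunE !opp_lfunE !rmul_shift0 => /eqP.
by rewrite subr_eq0 subr_eq => /eqP ->; rewrite -linearDr.
Qed.

End InnerDerivations.

(** * All derivations are inner *)

Local Open Scope complex_scope.

Theorem theorem6p4 (F : realType) (R : vectType F[i])
    (br : {bilinear R -> R -> R}) (N Q : {vspace R}) :
  right_leibniz br ->
  solvablev br {:R}%VS ->
  nilradical br N ->
  (N + Q)%VS = {:R}%VS ->
  directv (N + Q) ->
  \dim Q = dim_quot N (lower_central br N 2) ->
  forall d : 'End(R), derivation br d -> inner_derivation br d.
Proof.
move=> leib solv [Nideal Nnil Nmax] NQ dNQ dimQ d.
have NN : (bracketv br N N <= N)%VS.
  by apply: subv_trans Nideal.1; rewrite bracketvS ?subvf.
have [pi [iota [iotaN piK piE]]] := quotient_coord (lc_sub 0 NN) dimQ.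
have LLN := derived_sub_nilradical leib Nideal Nnil Nmax iotaN piK piE solv.
have rho_nil := rho_nilpotent_mem leib Nideal Nnil Nmax iotaN piK piE solv.
have rhoN := rho_N Nideal iotaN piE.
have dimN : (\dim N + \dim Q)%N = \dim {:R} by rewrite -NQ (directvP dNQ).
have rho_comm x y : rho br pi iota x *m rho br pi iota y
    = rho br pi iota y *m rho br pi iota x.
  apply/subr0_eq; rewrite -(rho_br leib Nideal iotaN piK piE).
  exact/rhoN/LLN.
have rhoQ x p : x \in Q -> rho br pi iota x ^+ p = 0 -> x = 0.
  move=> Qx /rho_nil Nx; apply/eqP; rewrite -memv0.
  by rewrite -(directv_addP dNQ) memv_cap Nx.
have [|x0 [V Vunit Veigen]] := exists_split_element rho_comm rhoQ
    (c := fun i => ((\dim Q).+1 + i)%:R).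
  by move=> i j /eqP; rewrite eqr_nat eqn_add2l => /eqP /val_inj.
have /fin_all_exists[e /all_and3[eN pie ex0]] :=
  eigenvector_lift leib Nnil LLN iotaN piK piE Vunit Veigen.
exact: (derivation_inner leib Nnil LLN iotaN piK piE rho_nil dimN Vunit Veigen
  eN pie ex0).
Qed.
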